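(* Let $S$ define a group action on $\mathcal{X}$, and let $h : \{S\cdot x \;|\; x\in\mathcal{X}\}\to\mathcal{X}$ be an orbit mapping that satisfies $h(S\cdot x)\in S\cdot x$ for all $x\in\mathcal{X}$. Any network $\mathcal{G}:\mathcal{X}\times\mathbb{R}^p\to\mathcal{X}$ that can be written as $$\mathcal{G}(x;\theta) = \hat{g}^{-1}\big(\mathcal{G}_2(\hat{g}(x);\theta)\big)$$ for an arbitrary network $\mathcal{G}_2:\mathcal{X}\times\mathbb{R}^p\to\mathcal{X}$, and $\hat{g}\in S$ denoting the element that satisfies $\hat{g}(x) = h(S\cdot x)$, is equivariant, i.e. $\mathcal{G}(g(x);\theta) = g(\mathcal{G}(x;\theta))$ for all $x\in\mathcal{X}$, $g\in S$, $\theta\in\mathbb{R}^p$.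
   Context: $\mathcal{X}$ is the input space (a set), and $S$ is a set of transformations $g:\mathcal{X}\to\mathcal{X}$ that is a group acting (from the left) on $\mathcal{X}$; $g(x)$ denotes the action of $g\in S$ on $x\in\mathcal{X}$, so that $e(x)=x$ for the identity $e$ and $g(g'(x)) = (gg')(x)$ for $g,g'\in S$. The orbit of $x\in\mathcal{X}$ is $S\cdot x=\{g(x)\;|\;g\in S\}$. An orbit mapping is a function $h:\{S\cdot x\;|\;x\in\mathcal{X}\}\to\mathcal{X}$ which uniquely selects a particular element from an orbit. A network is a function of an input $x\in\mathcal{X}$ and a parameter vector $\theta\in\mathbb{R}^p$. The element $\hat{g}$ depends on the input $x$.
   Formalization: The element ĝ with ĝ(x) = h(S·x) need not be unique if the action is not free, and an arbitrary choice can break equivariance; the formula for 𝒢 is therefore required for every such ĝ, which is the stated equation when ĝ is unique. *)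

(* Defs.v *)
From HB Require Import structures.
From mathcomp Require Export all_boot all_order all_algebra.
From mathcomp Require Export monoid.
From mathcomp Require Export boolp classical_sets reals.

Set Implicit Arguments.
Unset Strict Implicit.
Unset Printing Implicit Defensive.

Local Open Scope classical_set_scope.

(* MathComp's [action] is restricted to finite groups; [S] may be infinite. *)
Record left_action (S : groupType) (X : Type) := LeftAction {
  act :> S -> X -> X;
  act1 : forall x : X, act 1%g x = x;
  actM : forall (g g' : S) (x : X), act g (act g' x) = act (g * g')%g x
}.

Definition orbit (S : groupType) (X : Type) (a : left_action S X) (x : X) :
  set X := [set a g x | g in [set: S]].

Definition orbit_space (S : groupType) (X : Type) (a : left_action S X) :
  set (set X) := [set orbit a x | x in [set: X]].

Lemma orbit_in_space (S : groupType) (X : Type) (a : left_action S X) (x : X) :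
  orbit a x \in orbit_space a.
Proof. by apply/mem_set; exists x. Qed.

(* The orbit of [x], as an element of the subtype of [set X] made of orbits. *)
Definition orbit_of (S : groupType) (X : Type) (a : left_action S X) (x : X) :
  orbit_space a := exist _ (orbit a x) (orbit_in_space a x).

(* A network is an arbitrary function of the input and of [p] real parameters. *)
Definition network (R : realType) (p : nat) (X : Type) : Type :=
  X -> 'rV[R]_p -> X.

Definition equivariant (R : realType) (p : nat) (S : groupType) (X : Type)
    (a : left_action S X) (G : network R p X) : Prop :=
  forall (x : X) (g : S) (theta : 'rV[R]_p),
    G (a g x) theta = a g (G x theta).

(* [G] can be written as G(x; theta) = ghat^-1 (G2 (ghat x; theta)), [ghat]
   being the element with ghat x = h (S.x).  Such an element is determined only
   up to the stabilizer of h (S.x), so for it to be well defined in the formula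
   the identity is required of every element with that property.  It amounts
   to a single equation per (x, theta) when [ghat] is unique; when it is not,
   selecting one [ghat] for each [x] arbitrarily does not give an equivariant
   network in general. *)
Definition canonicalized_by (R : realType) (p : nat) (S : groupType) (X : Type)
    (a : left_action S X) (h : orbit_space a -> X)
    (G2 G : network R p X) : Prop :=
  forall (x : X) (theta : 'rV[R]_p) (ghat : S),
    a ghat x = h (orbit_of a x) ->
    G x theta = a (ghat^-1)%g (G2 (a ghat x) theta).

(* Main.v *)
Require Import Defs.

Local Open Scope classical_set_scope.

(** [x] and [g x] share an orbit ([orbit_of_act]), so [h] gives both the same canonical point and
    [G2] sees the same input; only the element undoing the canonicalization differs, by the factor
    [g]. *)

Lemma orbit_act (S : groupType) (X : Type) (a : left_action S X) (g : S)
    (x : X) :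
  orbit a (a g x) = orbit a x.
Proof.
apply/seteqP; split=> y [k _ <-].
  (* Right translation by [g] is a bijection of [S], whence both witnesses. *)
  by exists (k * g)%g => //; rewrite actM.
by exists (k * g^-1)%g => //; rewrite actM mulgVK.
Qed.

(** The form needed to rewrite under [h], whose argument bundles an orbit with a membership
    proof. *)
Lemma orbit_of_act (S : groupType) (X : Type) (a : left_action S X) (g : S)
    (x : X) :
  orbit_of a (a g x) = orbit_of a x.
Proof. by apply: val_inj; apply: orbit_act. Qed.

(* If [k] canonicalizes [x], then [k * g^-1] canonicalizes [g x], to the same
   point; its inverse [g * k^-1] contributes the factor [g]. *)
Theorem proposition2 (R : realType) (p : nat) (X : Type) (S : groupType)
    (a : left_action S X) (h : orbit_space a -> X)
    (h_in_orbit : forall x : X, orbit a x (h (orbit_of a x)))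
    (G G2 : network R p X)
    (G_form : canonicalized_by h G2 G) :
  equivariant a G.
Proof.
move=> x g theta; have [k _ kx] := h_in_orbit x.
have kgx : a (k * g^-1)%g (a g x) = a k x by rewrite actM mulgVK.
(* [G_form] covers every canonicalizing element, so this one may be chosen at [g x]. *)
rewrite (G_form _ _ (k * g^-1)%g) ?orbit_of_act ?kgx //.
by rewrite (G_form _ _ _ kx) actM invgM invgK.
Qed.
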